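(* Let $n=2d$ with $d\ge 2$ an integer, and let $\mathcal{F}\subset \mathbb F_q^{n}$ be the flat disk. Then $$ R^*_{\mathcal{F}} \left(2\to \frac{2n+4}{n-2}\right) =R^*_{\mathcal{F}} \left(2\to \frac{2d+2}{d-1}\right)\lesssim 1.$$
   Context: $\mathbb F_q$ is a finite field with $q$ elements, $q$ odd. For $d\ge 2$ and $n=2d$, the flat disk is $$\mathcal{F}:=\{(\alpha,\ \alpha\cdot\alpha,\ \beta,\ \alpha\cdot\beta):\ \alpha,\beta\in\mathbb F_q^{d-1}\}\subset \mathbb F_q^{2d},$$ where $\alpha\cdot\beta=\sum_{i}\alpha_i\beta_i$ is the usual dot product; $|\mathcal F|=q^{n-2}$. The canonical additive character of $\mathbb F_q$ is $\chi(c)=e^{2\pi i\,\mathrm{Tr}(c)/p_0}$, where $p_0$ is the characteristic of $\mathbb F_q$ and $\mathrm{Tr}:\mathbb F_q\to\mathbb F_{p_0}$ is the absolute trace. The normalized surface measure $d\sigma$ on $\mathcal F$ is $\int_{\mathcal F} f\,d\sigma=\frac1{|\mathcal F|}\sum_{x\in\mathcal F}f(x)$, so $\|f\|_{L^p(\mathcal F,d\sigma)}=\big(\frac1{|\mathcal F|}\sum_{x\in\mathcal F}|f(x)|^p\big)^{1/p}$ (maximum of $|f|$ if $p=\infty$). The space $(\mathbb F_q^n,dm)$ carries counting measure, so $\|g\|_{L^r(\mathbb F_q^n,dm)}=\big(\sum_{m}|g(m)|^r\big)^{1/r}$ (maximum if $r=\infty$). For $f:\mathcal F\to\mathbb C$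 and $m\in\mathbb F_q^n$, $$(fd\sigma)^\vee(m)=\frac1{|\mathcal F|}\sum_{x\in\mathcal F}\chi(x\cdot m)f(x).$$ For $1\le p,r\le\infty$, $R^*_{\mathcal F}(p\to r)$ is the smallest constant such that $\|(fd\sigma)^\vee\|_{L^r(\mathbb F_q^n,dm)}\le R^*_{\mathcal F}(p\to r)\,\|f\|_{L^p(\mathcal F,d\sigma)}$ for all $f:\mathcal F\to\mathbb C$. $A\lesssim B$ means $A\le CB$ for a constant $C>0$ independent of $q$ ($C$ may depend on the dimension and on the exponents). *)

(* Defs.v *)
From HB Require Import structures.
From mathcomp Require Import all_boot all_order all_algebra all_fingroup.
From mathcomp Require Import all_solvable all_field complex.
From mathcomp Require Import classical_sets reals ereal exp trigo.

Set Implicit Arguments.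
Unset Strict Implicit.
Unset Printing Implicit Defensive.

Import Order.TTheory GRing.Theory Num.Theory.
Local Open Scope ring_scope.

Section Character.
Variable F : finFieldType.

Definition field_char : nat := s2val (finPcharP F).

Lemma field_char_pchar : field_char \in [pchar F].
Proof. exact: (s2valP' (finPcharP F)). Qed.

(* F as a Galois extension of its prime field. *)
Local Notation L := (pPrimeCharType field_char_pchar).

Lemma abs_trace_exists (c : F) :
  exists k : 'F_field_char, galTrace 1 {:L} (c : L) == k%:A.
Proof.
have : galTrace 1 {:L} (c : L) \in (1 : {vspace L})%VS.
  by apply: mem_galTrace; rewrite ?memvf // finField_galois ?sub1v.
by case/vlineP=> k ->; exists k.
Qed.

(* galTrace takes values in L; abs_trace reads them in the prime field. *)
Definition abs_trace (c : F) : 'F_field_char := xchoose (abs_trace_exists c).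

Lemma abs_traceE (c : F) :
  (abs_trace c)%:R =
  \sum_(i < logn field_char #|F|) c ^+ (field_char ^ i) :> F.
Proof.
set p := field_char; set n := logn _ _.
have p_pr : prime p by apply: (pcharf_prime field_char_pchar).
have -> : (abs_trace c)%:R = galTrace 1 {:L} (c : L) :> F.
  rewrite (eqP (xchooseP (abs_trace_exists c))).
  by change ((abs_trace c)%:R = (abs_trace c)%:R * 1 :> F); rewrite mulr1.
have [g /eqP galE gE] := finField_galois_generator (sub1v {:L}).
have og : #[g]%g = n.
  rewrite orderE -galE -galois_dim ?finField_galois ?sub1v //.
  by rewrite dimv1 divn1 pprimeChar_dimf.
have gXE i (x : L) : (g ^+ i)%g x = x ^+ (p ^ i).
  elim: i => [|i IHi]; first by rewrite expg0 gal_id expn0 expr1.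
  rewrite expgSr galM ?memvf // IHi gE ?memvf // dimv1 expn1 card_Fp //.
  by rewrite expnSr exprM.
have cE : <[g]>%g = [set (g ^+ (i : 'I_n))%g | i in [set: 'I_n]].
  apply/setP=> x; apply/cycleP/imsetP => [[i ->]|[i _ ->]]; last by exists i.
  have n_gt0 : (0 < n)%N by rewrite -og order_gt0.
  exists (Ordinal (ltn_pmod i n_gt0)); first by rewrite inE.
  by rewrite /= -og expg_mod_order.
rewrite /galTrace galE cE big_imset /=.
  by apply: eq_big => [i|i _]; rewrite ?inE // gXE.
move=> i j _ _ /eqP; rewrite eq_expg_mod_order og !modn_small // => /eqP.
exact: val_inj.
Qed.

Variable R : realType.

(* The trace enters through its representative in {0, ..., p - 1}. *)
Definition chi (c : F) : R[i] :=
  let t := 2 * pi * (abs_trace c)%:R / field_char%:R : R in (cos t +i* sin t)%C.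

End Character.

Section FlatDisk.
Variable F : finFieldType.

Definition dot n (x y : 'rV[F]_n) : F := \sum_(i < n) x 0 i * y 0 i.

(* For 0 < d the width of the row is 2 * d, so that conform_mx only casts it
   to that type and the default value 0 is not used. *)
Definition flat_point d (a b : 'rV[F]_d.-1) : 'rV[F]_(2 * d) :=
  conform_mx 0
    (row_mx (row_mx a (const_mx (dot a a) : 'rV_1))
            (row_mx b (const_mx (dot a b) : 'rV_1))).

Definition flat_disk d : {set 'rV[F]_(2 * d)} :=
  [set flat_point a b | a : 'rV[F]_d.-1, b : 'rV[F]_d.-1].

Lemma flat_point_inj d : (0 < d)%N ->
  forall a b a' b', @flat_point d a b = flat_point a' b' -> a = a' /\ b = b'.
Proof.
move=> d0 a b a' b'; have e : (d.-1 + 1 + (d.-1 + 1) = 2 * d)%N.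
  by rewrite addn1 prednK // addnn mul2n.
rewrite /flat_point; move: (2 * d)%N e => n e.
case: n / e; rewrite !conform_mx_id => /eq_row_mx [/eq_row_mx [-> _]].
by case/eq_row_mx.
Qed.

Lemma card_flat_disk d : (0 < d)%N -> #|flat_disk d| = (#|F| ^ (2 * d - 2))%N.
Proof.
move=> d0; have -> : flat_disk d = [set flat_point u.1 u.2 | u : _ * _].
  apply/setP=> x; apply/imset2P/imsetP => [[a b _ _ ->]|[[a b] _ ->]].
    by exists (a, b).
  by exists a b.
rewrite card_in_imset.
  rewrite card_prod !card_mx -expnD; congr (_ ^ _)%N.
  by case: d d0 => // d _; rewrite /= mul1n addnn mul2n doubleS subn2.
by move=> [a b] [a' b'] _ _ /flat_point_inj-/(_ d0) [/= -> ->].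
Qed.

End FlatDisk.

Section Restriction.
Variables (F : finFieldType) (R : realType) (d : nat).
Local Notation V := 'rV[F]_(2 * d).

(* l^p norm over A with weight w at each point; 0 in the meaningless case
   p = -oo. *)
Definition Lp_norm (A : {set V}) (w : R) (p : \bar R) (f : V -> R[i]) : R :=
  match p with
  | s%:E%E => (w * \sum_(x in A) ComplexField.Normc.normc (f x) `^ s) `^ s^-1
  | +oo%E => \big[Num.max/0]_(x in A) ComplexField.Normc.normc (f x)
  | -oo%E => 0
  end.

(* Functions on the flat disk are represented by functions on the whole space;
   the values outside the disk are never used. *)
Definition disk_norm (p : \bar R) (f : V -> R[i]) : R :=
  Lp_norm (flat_disk F d) (#|flat_disk F d|%:R)^-1 p f.

Definition space_norm (r : \bar R) (g : V -> R[i]) : R :=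
  Lp_norm [set: V] 1 r g.

Definition extension (f : V -> R[i]) (m : V) : R[i] :=
  (#|flat_disk F d|%:R)^-1 * \sum_(x in flat_disk F d) chi R (dot x m) * f x.

Definition admissible (p r : \bar R) (C : R) : Prop :=
  forall f : V -> R[i], space_norm r (extension f) <= C * disk_norm p f.

(* Taken in the extended reals, so that an empty set of admissible constants
   would give +oo. *)
Definition Rstar (p r : \bar R) : \bar R :=
  ereal_inf [set C%:E | C in [set C : R | admissible p r C]]%classic%E.

End Restriction.

Arguments Rstar F R d p r : clear implicits.

(* Main.v *)
Require Import Defs.
From mathcomp Require Import all_boot all_order all_algebra.
From mathcomp Require Import all_field complex.
From mathcomp Require Import reals ereal exp trigo.
From mathcomp Require Import ring lra.
Import Order.TTheory GRing.Theory Num.Theory.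
Import ComplexField.Normc.

(** Write q for the cardinal of the field, G for the extension of f, u = |G|,
    r = (2d+2)/(d-1) and e = r - 2 = 4/(d-1).  Pair G with its dual function
    g = u^e G: with X the sum of the u^r, X = <G, g> is the pairing of f with
    the Fourier transform of g over the disk, and Cauchy-Schwarz together with
    the TT* identity reduces the theorem to
        | sum_(x, y) kappa (y - x) g x conj (g y) | <= D X^(2 - 2/r),
    where kappa is the inverse Fourier transform of the surface measure
    ([disk_kernel]) and D depends on d only.

    The kernel does not have uniform decay.  In coordinates (xi, s, eta, t), dual
    to (alpha, alpha.alpha, beta, alpha.beta), summing over beta forces
    eta + t alpha = 0.  Hence |kappa| <= q^(1-d) where t <> 0
    ([disk_kernel_transverse]), while on t = 0 the kernel is a paraboloid
    Gauss sum, at most q^((1-d)/2) in size away from the origin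
    ([disk_kernel_tangent]), and it is 1 at the origin.  The kernel is cut
    accordingly into three pieces, and the hyperplane t = 0 is cut out by
    averaging over translates of the disk along the last axis, so that each
    piece is still a combination of characters with an explicit L^2 bound:
    - t <> 0: supremum M^(1-d) and L^2 norm of order M^2, with M = q;
    - t = 0 minus the origin: the same two bounds with M the square root of q;
    - the origin: the identity operator ([sqnorm_level_le]).

    It is because both nontrivial pieces satisfy the pair M^(1-d), M^2 that a
    single exponent r serves for both: it is the one at which interpolation
    between L^1 -> L^oo and L^2 -> L^2 makes all powers of M cancel
    ([kernel_form_balanced]).  Complex interpolation is replaced by a
    real-variable argument ([kernel_form_split]): the double sum is cut at
    u x * u y = lambda, large pairs are controlled by the supremum of the
    kernel and small pairs by its L^2 bound, after a dyadic decomposition in x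
    only.  There is no endpoint loss, because the dyadic sums are
    geometric. *)

Set Implicit Arguments.
Unset Strict Implicit.
Unset Printing Implicit Defensive.
Local Open Scope ring_scope.
Local Open Scope complex_scope.

(** * Complex moduli *)

Section ComplexModulus.
Variable R : realType.
Local Notation C := R[i].
Implicit Types z : C.

Lemma normc_ge0 z : 0 <= normc z.
Proof. by case: z => a b; apply: sqrtr_ge0. Qed.

Lemma normc_conj z : normc (conjc z) = normc z.
Proof. by case: z => a b /=; rewrite sqrrN. Qed.

Lemma normc_real (a : R) : 0 <= a -> normc a%:C = a.
Proof. by move=> a0; rewrite /normc /= expr0n addr0 sqrtr_sqr ger0_norm. Qed.

Lemma mul_conj z : z * conjc z = (normc z ^+ 2)%:C.
Proof.
case: z => a b; rewrite /normc sqr_sqrtr ?addr_ge0 ?sqr_ge0 //.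
by apply/eqP; rewrite eq_complex /= mulrN opprK -!expr2 mulrN mulrC addNr !eqxx.
Qed.

Lemma conjc_scale (a : R) z : conjc (a%:C * z) = a%:C * conjc z.
Proof. by rewrite -[in RHS](conjc_real a); apply: rmorphM. Qed.

Lemma conjc_sum (I : Type) (s : seq I) (P : pred I) (f : I -> C) :
  conjc (\sum_(i <- s | P i) f i) = \sum_(i <- s | P i) conjc (f i).
Proof. exact: rmorph_sum. Qed.

Lemma normc_sum (I : Type) (s : seq I) (P : pred I) (f : I -> C) :
  normc (\sum_(i <- s | P i) f i) <= \sum_(i <- s | P i) normc (f i).
Proof.
elim/big_rec2: _ => [|i y x _ le_xy]; first by rewrite normc0.
by rewrite (le_trans (le_normcD _ _)) // lerD2l.
Qed.

Lemma normc_mul_le z1 z2 (s : R) : 0 < s ->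
  normc (z1 * conjc z2) <=
    1 / 2 * (s * normc z1 ^+ 2 + s^-1 * normc z2 ^+ 2).
Proof.
move=> s0; rewrite normcM normc_conj; set a := normc _; set b := normc _.
have -> : 1 / 2 * (s * a ^+ 2 + s^-1 * b ^+ 2) = a * b + (s * a - b) ^+ 2 / (2 * s).
  by field; rewrite gt_eqF.
by rewrite lerDl divr_ge0 ?sqr_ge0 // mulr_ge0 // ltW.
Qed.

End ComplexModulus.

(** * Interpolation between a supremum bound and an L^2 bound *)

Section InterpolationConstant.
Variable R : realType.
Implicit Type e : R.

(** The three terms come from the pairs above the threshold, from the loss 2^e
    inside one dyadic level, and from the geometric series of ratio 2^e. *)
Definition interp_const (e : R) : R :=
  1 + (2 `^ e + 2 `^ e / (2 `^ e - 1)).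

Lemma powR2_gt1 e : 0 < e -> 1 < 2 `^ e.
Proof.
move=> e0; have : 1 `^ e < 2 `^ e by apply: gt0_ltr_powR; rewrite ?nnegrE ?ltr1n.
by rewrite powR1.
Qed.

Lemma interp_const_gt0 e : 0 < e -> 0 < interp_const e.
Proof.
move=> /powR2_gt1 h; rewrite addr_gt0 // addr_gt0 ?powR_gt0 //.
by rewrite divr_gt0 ?powR_gt0 // subr_gt0.
Qed.

End InterpolationConstant.

Section Interpolation.
Variable R : realType.
Local Notation C := R[i].
Variable V : finType.

Definition kernel_form (K : V -> V -> C) (g h : V -> C) : C :=
  \sum_x \sum_y K x y * (g x * conjc (h y)).

Definition sqnorm (g : V -> C) : R := \sum_x normc (g x) ^+ 2.

(** Optimizing the weight w turns the bound into 2 B times the product of the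
    l^2 norms; the weighted form is kept because the proof needs a different
    weight on each dyadic level. *)
Definition l2_bounded (K : V -> V -> C) (B : R) : Prop :=
  forall g h w, 0 < w ->
    normc (kernel_form K g h) <= B * (w * sqnorm g + w^-1 * sqnorm h).

(** The function u^e G, where u = |G|, which is dual to G for the exponent
    e + 2: its pairing with G is [power_sum e G]. *)
Definition dual_power (e : R) (G : V -> C) (x : V) : C :=
  (normc (G x) `^ e)%:C * G x.

Definition power_sum (e : R) (G : V -> C) : R :=
  \sum_x normc (G x) `^ (e + 2).

Lemma sqnorm_ge0 g : 0 <= sqnorm g.
Proof. by apply: sumr_ge0 => x _; rewrite sqr_ge0. Qed.

(** Starting from a positive lower bound b of the nonzero values makes all
    levels natural numbers. *)
Lemma dyadic_levels (u : V -> R) :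
  exists b N (lev : V -> nat), [/\ 0 < b, forall x, (lev x < N)%N &
    forall x, 0 < u x -> b * 2 ^+ lev x <= u x < b * 2 ^+ (lev x).+1].
Proof.
have [b b0 hb] : exists2 b, 0 < b & forall x, 0 < u x -> b <= u x.
  exists (\big[Num.min/1]_(x | 0 < u x) u x).
    by elim/big_ind: _ => // x y x0 y0; rewrite lt_min x0.
  by move=> x ux; rewrite (bigD1 x) //= ge_min lexx.
have hex x : exists j, u x < b * 2 ^+ j.
  exists (Num.bound (u x / b)); rewrite mulrC -ltr_pdivrMr //.
  apply: le_lt_trans (real_ler_norm (num_real _)) _.
  apply: lt_le_trans (archi_boundP (normr_ge0 _)) _ => /=.
  have -> : Num.bound `|u x / b| = Num.bound (u x / b).
    by rewrite /Num.bound normr_id.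
  by rewrite -natrX ler_nat ltnW // ltn_expl.
pose lev x := (ex_minn (hex x)).-1.
exists b, (\max_x lev x).+1, lev; split=> // [x|x ux]; first exact: leq_bigmax.
rewrite /lev; case: ex_minnP => -[|j] hj hmin /=.
  by have := hb x ux; rewrite leNgt; move: hj; rewrite expr0 mulr1 => ->.
rewrite hj andbT leNgt; apply/negP => /hmin; by rewrite ltnn.
Qed.

(** An increasing geometric sum is comparable to its last term, which is at
    most L.  The induction carries both bounds: (rho - 1) times the sum
    telescopes below c rho^n, and below rho L as soon as a term is kept. *)
Lemma geometric_sum_le (c rho L : R) (n : nat) : 0 <= c -> 1 < rho -> 0 <= L ->
  \sum_(j < n | c * rho ^+ j <= L) c * rho ^+ j <= rho / (rho - 1) * L.
Proof.
move=> c0 rho1 L0; have r0 : 0 < rho - 1 by rewrite subr_gt0.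
suff [h _] : (rho - 1) * \sum_(j < n | c * rho ^+ j <= L) c * rho ^+ j <= rho * L
  /\ (rho - 1) * \sum_(j < n | c * rho ^+ j <= L) c * rho ^+ j <= c * rho ^+ n.
  by rewrite mulrAC ler_pdivlMr // mulrC.
elim: n => [|n [IH1 IH2]].
  by rewrite big_ord0 mulr0 expr0 mulr1 mulr_ge0 // ltW // (lt_trans ltr01).
rewrite big_mkcond big_ord_recr -big_mkcond /=.
have e : c * rho ^+ n.+1 = rho * (c * rho ^+ n) by rewrite exprS; ring.
have t0 : 0 <= c * rho ^+ n by rewrite mulr_ge0 // exprn_ge0 // ltW // (lt_trans ltr01).
rewrite e; case: ifP => h; last by rewrite addr0; split=> //; nra.
by split; nra.
Qed.

Variables (K : V -> V -> C) (A B e : R).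
Hypothesis e_gt0 : 0 < e.
Hypothesis B_ge0 : 0 <= B.
Hypothesis K_sup : forall x y, normc (K x y) <= A.
Hypothesis K_l2 : l2_bounded K B.

Variable G : V -> C.
Let u x := normc (G x).
Local Notation g := (dual_power e G).
Local Notation X := (power_sum e G).

Let XE : X = \sum_x u x `^ (e + 2). Proof. by []. Qed.

Let u_ge0 x : 0 <= u x. Proof. exact: normc_ge0. Qed.
Let rho_gt1 := powR2_gt1 e_gt0.

Let normg x : normc (g x) = u x `^ (e + 1).
Proof.
rewrite /dual_power normcM normc_real ?powR_ge0 // powRD ?powRr1 //.
by apply/implyP => /eqP h; exfalso; move: e_gt0; lra.
Qed.

Let powS a b x : 0 < a -> 0 < b -> u x `^ (a + b) = u x `^ a * u x `^ b.
Proof. by move=> a0 b0; rewrite powRD // gt_eqF // addr_gt0. Qed.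

(** Write v (lev x) for the dyadic value just below u x.  The cut is made at
    v (lev x) * u y = lam instead of u x * u y = lam, because the small pairs
    then form, on each level of x, a product set, to which the L^2 bound
    applies; large pairs still satisfy lam < u x * u y. *)
Lemma kernel_form_split lam : 0 < lam ->
  normc (kernel_form K g g) <= A / lam * X ^+ 2
    + B * (lam `^ (e / 2) * X * (2 `^ e + 2 `^ e / (2 `^ e - 1))).
Proof.
move=> lam0; have [b [n [lev [b0 hn hlev]]]] := dyadic_levels u.
have A0 (x : V) : 0 <= A by apply: le_trans (K_sup x x); apply: normc_ge0.
pose v j := b * 2 ^+ j; have v0 j : 0 < v j by rewrite mulr_gt0 ?exprn_gt0.
pose T x y := K x y * (g x * conjc (g y)).
pose s := lam `^ (e / 2); have s0 : 0 < s by rewrite powR_gt0.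
have ss : s * s = lam `^ e.
  by rewrite -powRD; [congr (_ `^ _); field | apply/implyP => _; rewrite gt_eqF].
have -> : kernel_form K g g = \sum_x \sum_(y | ~~ (v (lev x) * u y <= lam)) T x y
     + \sum_x \sum_(y | v (lev x) * u y <= lam) T x y.
  rewrite -big_split /=; apply: eq_bigr => x _.
  by rewrite [LHS](bigID (fun y => v (lev x) * u y <= lam)) /= addrC.
apply: le_trans (le_normcD _ _) _; apply: lerD.
  (* Large pairs: insert the factor u x * u y / lam, which is at least 1. *)
  apply: le_trans (normc_sum _ _ _) _.
  rewrite expr2 XE mulr_suml mulr_sumr; apply: ler_sum => x _.
  apply: le_trans (normc_sum _ _ _) _.
  rewrite big_mkcond mulr_sumr mulr_sumr; apply: ler_sum => y _.
  have Al0 : 0 <= A / lam by rewrite divr_ge0 ?(A0 x) ?ltW.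
  case: ifP => [|_]; last first.
    by apply: mulr_ge0 => //; rewrite mulr_ge0 ?powR_ge0.
  rewrite -ltNge => hl; rewrite normcM [normc (_ * conjc _)]normcM normc_conj !normg.
  have [/eqP ux|ux] := boolP (u x == 0).
    by rewrite ux !powR0 ?gt_eqF ?addr_gt0 // !mul0r !mulr0.
  have {}ux : 0 < u x by rewrite lt_def ux u_ge0.
  have lv := proj1 (andP (hlev _ ux)).
  have luu : lam <= u x * u y.
    by rewrite (le_trans (ltW hl)) // ler_wpM2r.
  have E z : u z `^ (e + 2) = u z `^ (e + 1) * u z.
    rewrite -[Y in _ * Y]powRr1 // -powS ?addr_gt0 //; congr (_ `^ _); ring.
  rewrite !E; set p := u x `^ _; set q := u y `^ _.
  have -> : A / lam * (p * u x * (q * u y)) = A * (p * q) * ((u x * u y) / lam) by ring.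
  have p0 : 0 <= p * q by rewrite mulr_ge0 ?powR_ge0.
  apply: (@le_trans _ _ (A * (p * q))).
    by apply: ler_wpM2r => //; apply: K_sup.
  by rewrite ler_peMr ?mulr_ge0 ?(A0 x) ?powR_ge0 // ler_pdivlMr ?mul1r.
(* Small pairs: on level j, x and y range over the supports of gj j and hj j. *)
pose gj j x := if lev x == j then g x else 0.
pose hj j y := if v j * u y <= lam then g y else 0.
have -> : \sum_x \sum_(y | v (lev x) * u y <= lam) T x y
    = \sum_(j < n) kernel_form K (gj j) (hj j).
  rewrite /kernel_form exchange_big /=; apply: eq_bigr => x _.
  rewrite (bigD1 (Ordinal (hn x))) //= [Y in _ + Y]big1 ?addr0; last first.
    move=> j hjx; rewrite big1 // => y _; rewrite /gj ifN ?mul0r ?mulr0 //.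
    by apply: contra hjx => /eqP h; apply/eqP/val_inj.
  rewrite big_mkcond; apply: eq_bigr => y _; rewrite /gj eqxx /hj.
  by case: ifP; rewrite // rmorph0 !mulr0.
apply: le_trans (normc_sum _ _ _) _.
(* This weight makes both halves of the L^2 bound homogeneous: they become s
   times a sum of u^(e + 2). *)
pose w j := s * v j `^ (- e).
have w0 j : 0 < w j by rewrite mulr_gt0 ?powR_gt0.
apply: (@le_trans _ _ (\sum_(j < n)
    B * (w j * sqnorm (gj j) + (w j)^-1 * sqnorm (hj j)))).
  by apply: ler_sum => j _; apply: K_l2.
rewrite -mulr_sumr ler_wpM2l // big_split /= mulrDr; apply: lerD.
  have -> : \sum_(j < n) w j * sqnorm (gj j) = \sum_x w (lev x) * normc (g x) ^+ 2.
    under eq_bigr do rewrite mulr_sumr.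
    rewrite exchange_big /=; apply: eq_bigr => x _.
    rewrite (bigD1 (Ordinal (hn x))) //= [Y in _ + Y]big1 ?addr0 /gj ?eqxx //.
    move=> j hjx; rewrite ifN ?normc0 ?expr0n ?mulr0 //.
    by apply: contra hjx => /eqP h; apply/eqP/val_inj.
  rewrite -/s XE -mulrA mulr_suml mulr_sumr; apply: ler_sum => x _.
  rewrite /w -mulrA ler_pM2l // normg.
  have [/eqP ux|ux] := boolP (u x == 0).
    rewrite ux !powR0 ?gt_eqF ?addr_gt0 // expr0n !(mulr0, mul0r) //.
  have {}ux : 0 < u x by rewrite lt_def ux u_ge0.
  have E : (u x `^ (e + 1)) ^+ 2 = u x `^ (e + 2) * u x `^ e.
    rewrite expr2 -!powS ?addr_gt0 //; congr (_ `^ _); ring.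
  rewrite E mulrCA; apply: ler_wpM2l; first exact: powR_ge0.
  rewrite powRN mulrC ler_pdivrMr ?powR_gt0 // -powRM //; last exact: ltW.
  apply: ge0_ler_powR; rewrite ?nnegrE ?mulr_ge0 // ?ltW //.
  by have /andP[_] := hlev _ ux; rewrite exprS mulrCA.
have -> : \sum_(j < n) (w j)^-1 * sqnorm (hj j)
    = \sum_y normc (g y) ^+ 2 * (s^-1 * \sum_(j < n | v j * u y <= lam) v j `^ e).
  under eq_bigr do rewrite mulr_sumr.
  rewrite exchange_big /=; apply: eq_bigr => y _.
  rewrite mulr_sumr mulr_sumr [RHS]big_mkcond; apply: eq_bigr => j _.
  rewrite /w /hj powRN invfM invrK; case: ifP => _; first by rewrite mulrC.
  by rewrite normc0 expr0n mulr0.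
rewrite -/s XE -mulrA mulr_suml mulr_sumr; apply: ler_sum => y _; rewrite normg.
have [/eqP uy|uy] := boolP (u y == 0).
  by rewrite uy !powR0 ?gt_eqF ?addr_gt0 // expr0n !(mulr0, mul0r).
have {}uy : 0 < u y by rewrite lt_def uy u_ge0.
have E : (u y `^ (e + 1)) ^+ 2 = u y `^ (e + 2) * u y `^ e.
  rewrite expr2 -!powS ?addr_gt0 //; congr (_ `^ _); ring.
have ve j : v j `^ e = b `^ e * (2 `^ e) ^+ j.
  rewrite powRM ?exprn_ge0 // ?ltW //; congr (_ * _).
  by rewrite -!powR_mulrn ?powR_ge0 // -!powRrM mulrC.
(* For a fixed y, only the levels with v j <= lam / u y contribute. *)
have geo : \sum_(j < n | v j * u y <= lam) v j `^ e
    <= 2 `^ e / (2 `^ e - 1) * (lam / u y) `^ e.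
  have L0 : 0 <= (lam / u y) `^ e by exact: powR_ge0.
  apply: le_trans (geometric_sum_le n (powR_ge0 b e) rho_gt1 L0).
  rewrite le_eqVlt; apply/orP; left; apply/eqP; apply: eq_big => [j|j _]; last exact: ve.
  rewrite -ve -ler_pdivlMr //.
  have q0 : 0 <= lam / u y by rewrite ltW // divr_gt0.
  apply/idP/idP => [h|].
    by apply: ge0_ler_powR => //; rewrite ?nnegrE ltW.
  apply: contraTT; rewrite -!ltNge => h.
  by apply: gt0_ltr_powR; rewrite ?nnegrE // ltW.
have LE : (lam / u y) `^ e = s * s / u y `^ e.
  rewrite powRM ?invr_ge0 ?ltW // ss; congr (_ * _).
  by rewrite -(powR_inv1 (ltW uy)) -powRrM mulN1r powRN.
apply: le_trans (ler_wpM2l _ (ler_wpM2l _ geo)) _.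
- by rewrite sqr_ge0.
- by rewrite invr_ge0 ltW.
rewrite LE E le_eqVlt; apply/orP; left; apply/eqP.
have ue : u y `^ e != 0 by rewrite gt_eqF // powR_gt0.
have re : 2 `^ e - 1 != 0 by rewrite subr_eq0 gt_eqF.
have sn : s != 0 by rewrite gt_eqF.
by field; rewrite ?ue ?re ?sn.
Qed.

(** The largest value of u is at most X^(1/(e+2)), so that e of the 2e + 2
    factors u can be bounded by X and the others sum to X. *)
Lemma sqnorm_level_le : sqnorm g <= X `^ (2 - 2 / (e + 2)).
Proof.
have r0 : 0 < e + 2 by rewrite addr_gt0.
have X0 : 0 <= X by apply: sumr_ge0 => y _; apply: powR_ge0.
have uX x : u x `^ e <= X `^ (e / (e + 2)).
  have -> : u x `^ e = (u x `^ (e + 2)) `^ (e / (e + 2)).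
    by rewrite -powRrM; congr (_ `^ _); field; rewrite gt_eqF.
  apply: ge0_ler_powR; rewrite ?nnegrE ?powR_ge0 //; first by rewrite divr_ge0 ?ltW.
  rewrite XE (bigD1 x) //= lerDl sumr_ge0 // => y _; exact: powR_ge0.
have -> : X `^ (2 - 2 / (e + 2)) = X * X `^ (e / (e + 2)).
  rewrite -{2}(powRr1 X0) -powRD; first by congr (_ `^ _); field; rewrite gt_eqF.
  by rewrite gt_eqF // addr_gt0 // divr_gt0.
rewrite /sqnorm {1}XE mulr_suml; apply: ler_sum => x _; rewrite normg.
have -> : (u x `^ (e + 1)) ^+ 2 = u x `^ (e + 2) * u x `^ e.
  rewrite expr2 -!powS ?addr_gt0 //; congr (_ `^ _); ring.
by apply: ler_wpM2l => //; apply: powR_ge0.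
Qed.

(** The relation e = 4 / k is the endpoint: with lam chosen so that the two
    terms of [kernel_form_split] balance, no power of M is left. *)
Lemma kernel_form_balanced (M : R) (k : nat) : 0 < M -> (0 < k)%N -> 0 < X ->
  e = 4 / k%:R -> A = M ^- k -> B = M ^+ 2 ->
  normc (kernel_form K g g) <= interp_const e * X `^ (2 - 2 / (e + 2)).
Proof.
move=> M0 k0 X0 ek AM BM.
have k0' : 0 < k%:R :> R by rewrite ltr0n.
have kn : k%:R != 0 :> R by rewrite gt_eqF.
have e2 : e + 2 != 0 by rewrite gt_eqF // addr_gt0.
have k2 : k%:R * 2 + 4 != 0 :> R by rewrite gt_eqF // addr_gt0 // mulr_gt0.
pose lam := M ^- k * X `^ (2 / (e + 2)).
have lam0 : 0 < lam by rewrite mulr_gt0 ?invr_gt0 ?exprn_gt0 ?powR_gt0.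
have XD a b : X `^ (a + b) = X `^ a * X `^ b.
  by rewrite powRD //; apply/implyP => _; rewrite gt_eqF.
apply: le_trans (kernel_form_split lam0) _.
rewrite /interp_const mulrDl mul1r; apply: lerD.
  rewrite le_eqVlt; apply/orP; left; apply/eqP.
  rewrite XD powRN powR_mulrn ?ltW // AM /lam.
  have Mk : M ^+ k != 0 by rewrite gt_eqF // exprn_gt0.
  have Xr : X `^ (2 / (e + 2)) != 0 by rewrite gt_eqF // powR_gt0.
  by field; rewrite Mk Xr.
rewrite le_eqVlt; apply/orP; left; apply/eqP.
have -> : lam `^ (e / 2) = M ^- 2 * X `^ (2 / (e + 2) * (e / 2)).
  rewrite powRM ?powR_ge0 ?invr_ge0 ?exprn_ge0 ?ltW // -powRrM; congr (_ * _).
  rewrite -powR_invn ?ltW // -powRrM -powR_invn ?ltW //; congr (_ `^ _).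
  by rewrite ek; field.
have -> : X `^ (2 - 2 / (e + 2)) = X * X `^ (2 / (e + 2) * (e / 2)).
  rewrite -{2}(powRr1 (ltW X0)) -XD; congr (_ `^ _).
  by field; rewrite e2.
rewrite BM; have Mn : M != 0 by rewrite gt_eqF.
set S := 2 `^ e + _; set Y := X `^ _.
by field.
Qed.

End Interpolation.

(** * The additive character *)

Section CharacterSums.
Variables (R : realType) (F : finFieldType).
Local Notation C := R[i].
Local Notation p := (field_char F).
Local Notation q := (#|F|%:R : R).
Implicit Types a b c : F.

Let pP := field_char_pchar F.
Let p_prime : prime p. Proof. exact: pcharf_prime pP. Qed.

Lemma abs_trace_lt c : (abs_trace c < p)%N.
Proof. by rewrite -[X in (_ < X)%N](Fp_cast p_prime) ltn_ord. Qed.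

Lemma abs_traceD (a b : F) :
  (abs_trace a + abs_trace b)%N = abs_trace (a + b)%R %[mod p].
Proof.
have h : (abs_trace a + abs_trace b)%:R = (abs_trace (a + b))%:R :> F.
  rewrite natrD !abs_traceE -big_split; apply: eq_bigr => i _ /=.
  by rewrite (exprDn_pchar _ _ (n := (p ^ i)%N)) // pnatX pnatE // pP.
apply/eqP; have [le|/ltnW le] := leqP (abs_trace (a + b)) (abs_trace a + abs_trace b).
  by rewrite eqn_mod_dvd // (dvdn_pcharf pP) natrB // h subrr.
by rewrite eq_sym eqn_mod_dvd // (dvdn_pcharf pP) natrB // h subrr.
Qed.

(** The trace is a polynomial function of degree p^(n-1), where q = p^n, so it
    has fewer than q zeros. *)
Lemma abs_trace_neq0 : exists c, abs_trace c != 0%N :> nat.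
Proof.
apply/existsP; rewrite -[X in is_true X]negbK negb_exists; apply/negP => /forallP h.
set n := logn p #|F|.
have cF : #|F| = (p ^ n)%N by apply: card_pprimeChar pP.
have n0 : (0 < n)%N.
  by rewrite lt0n; apply/eqP => n0; have := finNzRing_gt1 F; rewrite cF n0.
pose P : {poly F} := \sum_(i < n) 'X^(p ^ i).
have p1 : (1 < p)%N by apply: prime_gt1.
have nn : (n.-1 < n)%N by rewrite prednK.
have Pc : P`_(p ^ n.-1) = 1.
  rewrite coef_sum (bigD1 (Ordinal nn)) //=.
  rewrite coefXn eqxx big1 ?addr0 // => i hi; rewrite coefXn eqn_exp2l //.
  by rewrite eq_sym (negPf (contraNneq _ hi)) // => h'; apply/eqP/val_inj.
have P0 : P != 0.
  by apply/eqP => P0; move/eqP: Pc; rewrite P0 coef0 eq_sym oner_eq0.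
have sP : (size P <= (p ^ n.-1).+1)%N.
  rewrite (leq_trans (size_sum _ _ _)) //; apply/bigmax_leqP => i _.
  by rewrite size_polyXn ltnS leq_exp2l // -ltnS prednK.
have rP : all (root P) (enum F).
  apply/allP => c _; rewrite /root horner_sum.
  under eq_bigr do rewrite hornerXn.
  by have /negPn/eqP c0 := h c; rewrite -abs_traceE c0.
have := leq_trans (max_poly_roots P0 rP (enum_uniq _)) sP.
by rewrite -cardE cF ltnS leq_exp2l // -ltnS prednK // ltnn.
Qed.

Let cis (k : nat) : C :=
  let t := 2 * pi * k%:R / p%:R : R in cos t +i* sin t.

Let p_neq0 : p%:R != 0 :> R.
Proof. by rewrite pnatr_eq0 -lt0n prime_gt0. Qed.

Let cisD m n : cis (m + n) = cis m * cis n.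
Proof.
rewrite /cis natrD mulrDr mulrDl.
set x := _ / _; set y := _ / _.
by apply/eqP; rewrite eq_complex /= cosD sinD; apply/andP; split; apply/eqP; ring.
Qed.

Let cis_mod m : cis (m %% p) = cis m.
Proof.
have c1 : cis p = 1.
  rewrite /cis mulfK // [2 * pi]mulrC mulr_natr cos2pi sin2pi.
  by apply/eqP; rewrite eq_complex /= !eqxx.
have cm k : cis (k * p) = 1.
  elim: k => [|k IH]; last by rewrite mulSn cisD c1 IH mulr1.
  rewrite /cis mul0n mulr0 mul0r cos0 sin0.
  by apply/eqP; rewrite eq_complex /= !eqxx.
by rewrite [in RHS](divn_eq m p) cisD cm mul1r.
Qed.

Lemma chiD a b : chi R (a + b) = chi R a * chi R b.
Proof.
change (cis (abs_trace (a + b)) = cis (abs_trace a) * cis (abs_trace b)).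
by rewrite -cisD -cis_mod -abs_traceD cis_mod.
Qed.

Lemma normc_chi a : normc (chi R a) = 1.
Proof. by rewrite /chi /normc cos2Dsin2 sqrtr1. Qed.

Lemma chi0 : chi R (0 : F) = 1.
Proof.
have h : chi R (0 : F) != 0.
  apply/eqP => h; have := normc_chi 0; rewrite h normc0 => /eqP.
  by rewrite eq_sym oner_eq0.
by apply: (mulfI h); rewrite -chiD addr0 mulr1.
Qed.

Lemma conj_chi a : conjc (chi R a) = chi R (- a).
Proof.
have h : chi R a * conjc (chi R a) = 1 by rewrite mul_conj normc_chi expr1n.
have h0 : chi R a != 0.
  by apply/eqP => h1; move/eqP: h; rewrite h1 mul0r eq_sym oner_eq0.
by apply: (mulfI h0); rewrite h -chiD subrr chi0.
Qed.

(** If the trace is k with 0 < k < p, then cos (2 pi k / p) = 1 would force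
    sin (pi k / p) = 0. *)
Lemma chi_nontrivial : exists c, chi R c != 1.
Proof.
have [c hc] := abs_trace_neq0; exists c; apply/eqP => -[].
pose x : R := pi * (abs_trace c)%:R / p%:R.
have -> : 2 * pi * (abs_trace c)%:R / p%:R = x *+ 2 :> R.
  by rewrite /x -[RHS]mulr_natl !mulrA.
rewrite cos_mulr2n => h _.
have sx : 0 < sin x.
  have p0 : 0 < p%:R :> R by rewrite ltr0n prime_gt0.
  have t0 : 0 < (abs_trace c)%:R :> R by rewrite ltr0n lt0n.
  apply: sin_gt0_pi; apply/andP; split; first by rewrite divr_gt0 ?mulr_gt0 ?pi_gt0.
  by rewrite ltr_pdivrMr // ltr_pM2l ?pi_gt0 // ltr_nat abs_trace_lt.
have := exprn_gt0 2 sx; have := cos2Dsin2 x.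
by move: h; rewrite -mulr_natl; lra.
Qed.

(** Translating by a multiplies the sum by f a, which is not 1. *)
Lemma additive_sum_eq0 (T : finZmodType) (f : T -> C) (a : T) :
  {morph f : x y / x + y >-> x * y} -> f a != 1 -> \sum_x f x = 0.
Proof.
move=> fD fa; apply/eqP; rewrite -(mulrI_eq0 _ (x := f a - 1)); last first.
  by apply/lregP; rewrite subr_eq0.
rewrite mulrBl mul1r mulr_sumr subr_eq0; apply/eqP.
by rewrite [RHS](reindex_inj (addrI a)); apply: eq_bigr => x _; rewrite fD.
Qed.

Lemma dotDl n (a b v : 'rV[F]_n) : dot (a + b) v = dot a v + dot b v.
Proof. by rewrite -big_split; apply: eq_bigr => i _; rewrite mxE mulrDl. Qed.

Lemma dotC n (a b : 'rV[F]_n) : dot a b = dot b a.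
Proof. by apply: eq_bigr => i _; rewrite mulrC. Qed.

Lemma dotZl n c (a v : 'rV[F]_n) : dot (c *: a) v = c * dot a v.
Proof. by rewrite mulr_sumr; apply: eq_bigr => i _; rewrite mxE mulrA. Qed.

Lemma dotNl n (a v : 'rV[F]_n) : dot (- a) v = - dot a v.
Proof. by rewrite -scaleN1r dotZl mulN1r. Qed.

Lemma dot0l n (v : 'rV[F]_n) : dot 0 v = 0.
Proof. by rewrite -(scale0r 0) dotZl mul0r. Qed.

Lemma sum_chi_dot n (v : 'rV[F]_n) :
  \sum_a chi R (dot a v) = if v == 0 then (#|F| ^ n)%:R else 0.
Proof.
have [->|v0] := eqVneq.
  under eq_bigr do rewrite dotC dot0l chi0.
  by rewrite sumr_const card_mx mul1n.
have [i vi] : exists i, v 0 i != 0.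
  by apply/existsP; apply: contraNT v0; rewrite negb_exists => /forallP h;
    apply/eqP/rowP => i; rewrite mxE; apply/eqP; have := h i; rewrite negbK.
have [c hc] := chi_nontrivial.
apply: (additive_sum_eq0 (a := (c / v 0 i) *: delta_mx 0 i)) => [a b|].
  by rewrite dotDl chiD.
rewrite dotZl /dot (bigD1 i) //= big1 => [|j hj].
  by rewrite !mxE !eqxx mul1r addr0 divfK.
by rewrite mxE (negPf hj) andbF mul0r.
Qed.

Lemma sum_chi_mul (t : F) :
  \sum_c chi R (c * t) = if t == 0 then (#|F|%:R : C) else 0.
Proof.
have [->|t0] := eqVneq.
  by under eq_bigr do rewrite mulr0 chi0; rewrite sumr_const.
have [c hc] := chi_nontrivial.
apply: (additive_sum_eq0 (a := c / t)) => [a b|]; last by rewrite divfK.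
by rewrite mulrDl chiD.
Qed.

End CharacterSums.

(** * Plancherel bounds for combinations of characters *)

Section Plancherel.
Variables (R : realType) (F : finFieldType) (n : nat).
Local Notation C := R[i].
Local Notation V := 'rV[F]_n.

(** The sign is opposite to that of the extension operator, so that the Fourier
    transform restricted to the disk is its adjoint. *)
Definition fourier (g : V -> C) (z : V) : C :=
  \sum_x conjc (chi R (dot z x)) * g x.

Definition translation_kernel (k : V -> C) (x y : V) : C := k (y - x).

Definition exp_sum (I : finType) (w : I -> V) (m : V) : C :=
  \sum_i chi R (dot (w i) m).

Lemma chi_dotB (z x y : V) :
  chi R (dot z (y - x)) = conjc (chi R (dot z x)) * chi R (dot z y).
Proof. by rewrite conj_chi -chiD dotC dotDl dotNl addrC ![dot _ z]dotC. Qed.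

(** The TT* identity. *)
Lemma kernel_form_exp_sum (I : finType) (w : I -> V) (c : R) g h :
  kernel_form (translation_kernel (fun m => c%:C * exp_sum w m)) g h =
    c%:C * \sum_i fourier g (w i) * conjc (fourier h (w i)).
Proof.
rewrite /kernel_form; under eq_bigr do under eq_bigr do rewrite -mulrA mulr_suml.
under eq_bigr do rewrite -mulr_sumr exchange_big.
rewrite -mulr_sumr exchange_big /=; congr (_ * _); apply: eq_bigr => i _.
rewrite /fourier mulr_suml; apply: eq_bigr => x _.
rewrite rmorph_sum mulr_sumr; apply: eq_bigr => y _.
rewrite chi_dotB; move: (chi R _) (chi R _) => a b.
by rewrite rmorphM /= conjcK; ring.
Qed.

(** Plancherel, read off from the TT* identity for the family of all
    frequencies, whose kernel is a multiple of the point mass at 0. *)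
Lemma sqnorm_fourier g :
  sqnorm (fourier g) = (#|F| ^ n)%:R * sqnorm g.
Proof.
apply: complexI; rewrite /sqnorm rmorphM rmorph_nat !rmorph_sum /=.
under eq_bigr do rewrite -mul_conj.
under [in RHS]eq_bigr do rewrite -mul_conj.
have := kernel_form_exp_sum id 1 g g; rewrite mul1r => <-.
rewrite /kernel_form mulr_sumr; apply: eq_bigr => x _.
rewrite (bigD1 x) //= /translation_kernel mul1r /exp_sum sum_chi_dot subrr eqxx.
rewrite big1 ?addr0 // => y yx.
by rewrite mul1r sum_chi_dot subr_eq0 (negPf yx) mul0r.
Qed.

(** Since the frequencies w i are distinct, the sums over i are dominated by the
    sums over the whole dual group, where Plancherel applies. *)
Lemma l2_bounded_exp_sum (I : finType) (w : I -> V) (c : R) : injective w ->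
  0 <= c -> l2_bounded (translation_kernel (fun m => c%:C * exp_sum w m))
                       (c * (#|F| ^ n)%:R / 2).
Proof.
move=> wI c0 g h s s0; rewrite kernel_form_exp_sum normcM normc_real // -!mulrA.
apply: ler_wpM2l => //.
have sub f : \sum_i normc (fourier f (w i)) ^+ 2 <= (#|F| ^ n)%:R * sqnorm f.
  rewrite -sqnorm_fourier /sqnorm [leRHS](bigID (mem (w @: [set: I]))) /=.
  rewrite big_imset /=; last by move=> i j _ _; apply: wI.
  rewrite [X in _ <= X + _](eq_bigl xpredT) => [|i]; last by rewrite inE.
  by rewrite lerDl sumr_ge0 // => z _; rewrite sqr_ge0.
apply: le_trans (normc_sum _ _ _) _.
apply: (@le_trans _ _ (2^-1 * (s * \sum_i normc (fourier g (w i)) ^+ 2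
    + s^-1 * \sum_i normc (fourier h (w i)) ^+ 2))).
  rewrite !mulr_sumr -big_split /= mulr_sumr; apply: ler_sum => i _.
  by rewrite -[2^-1]mul1r normc_mul_le.
have -> : (#|F| ^ n)%:R * (2^-1 * (s * sqnorm g + s^-1 * sqnorm h)) =
   2^-1 * (s * ((#|F| ^ n)%:R * sqnorm g) + s^-1 * ((#|F| ^ n)%:R * sqnorm h)) by ring.
rewrite ler_wpM2l ?invr_ge0 ?ler0n //; apply: lerD; rewrite ler_wpM2l ?sub //.
  exact: ltW.
by rewrite invr_ge0 ltW.
Qed.

Lemma l2_bounded_le (T : finType) (K : T -> T -> C) B B' :
  B <= B' -> l2_bounded K B -> l2_bounded K B'.
Proof.
move=> BB hK g h s s0; apply: le_trans (hK g h s s0) _.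
by rewrite ler_wpM2r // addr_ge0 // mulr_ge0 ?invr_ge0 ?sqnorm_ge0 // ltW.
Qed.

Lemma l2_bounded_sub (T : finType) (K K' : T -> T -> C) B B' :
  l2_bounded K B -> l2_bounded K' B' ->
  l2_bounded (fun x y => K x y - K' x y) (B + B').
Proof.
move=> hK hK' g h s s0.
have -> : kernel_form (fun x y => K x y - K' x y) g h =
    kernel_form K g h - kernel_form K' g h.
  rewrite -sumrB; apply: eq_bigr => x _; rewrite -sumrB; apply: eq_bigr => y _.
  by rewrite mulrBl.
apply: le_trans (le_normcD _ _) _; rewrite normcN mulrDl.
by apply: lerD; [apply: hK | apply: hK'].
Qed.

End Plancherel.

(** * Coordinates adapted to the disk *)

Section Coordinates.
Variables (F : finFieldType) (k n : nat).
Hypothesis hn : (k + 1 + (k + 1) = n)%N.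
Implicit Types (a b : 'rV[F]_k) (s t : F).

(** The width n is kept apart from the sum k + 1 + (k + 1), to which it is only
    propositionally equal in the case n = 2 * d. *)
Definition coords a s b t : 'rV[F]_n :=
  conform_mx 0 (row_mx (row_mx a (const_mx s : 'rV_1))
                       (row_mx b (const_mx t : 'rV_1))).

Lemma coords_onto (m : 'rV[F]_n) : exists a s b t, m = coords a s b t.
Proof.
rewrite /coords; case: n / hn m => m.
exists (lsubmx (lsubmx m)), (rsubmx (lsubmx m) 0 0),
  (lsubmx (rsubmx m)), (rsubmx (rsubmx m) 0 0); rewrite conform_mx_id.
have c (x : 'rV[F]_1) : const_mx (x 0 0) = x.
  by apply/rowP => i; rewrite mxE ord1.
by rewrite !c !hsubmxK.
Qed.

Lemma coords_inj a s b t a' s' b' t' :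
  coords a s b t = coords a' s' b' t' -> [/\ a = a', s = s', b = b' & t = t'].
Proof.
rewrite /coords; case: n / hn; rewrite !conform_mx_id => /eq_row_mx [].
have c (x y : F) : const_mx x = const_mx y :> 'rV_1 -> x = y.
  by move=> /rowP /(_ 0); rewrite !mxE.
by move=> /eq_row_mx [-> /c ->] /eq_row_mx [-> /c ->].
Qed.

Lemma dot_coords a s b t a' s' b' t' :
  dot (coords a s b t) (coords a' s' b' t')
    = dot a a' + s * s' + (dot b b' + t * t').
Proof.
rewrite /coords; case: n / hn; rewrite !conform_mx_id.
have dr m1 m2 (x x' : 'rV[F]_m1) (y y' : 'rV[F]_m2) :
  dot (row_mx x y) (row_mx x' y') = dot x x' + dot y y'.
  rewrite /dot big_split_ord; congr (_ + _); apply: eq_bigr => i _;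
  by rewrite ?row_mxEl ?row_mxEr.
by rewrite !dr /dot !big_ord1 !mxE.
Qed.

Lemma coordsDlast a s b t c :
  coords a s b t + c *: coords 0 0 0 1 = coords a s b (t + c).
Proof.
rewrite /coords; case: n / hn; rewrite !conform_mx_id.
rewrite scale_row_mx !scale_row_mx !scaler0 add_row_mx !add_row_mx !addr0.
by have -> : const_mx t + c *: const_mx 1 = const_mx (t + c) :> 'rV_1;
  [apply/rowP => i; rewrite !mxE mulr1 | ].
Qed.

Lemma coords0 : coords 0 0 0 0 = 0.
Proof.
rewrite /coords; case: n / hn; rewrite !conform_mx_id.
have -> : const_mx 0 = 0 :> 'rV[F]_1 by apply/rowP => i; rewrite !mxE.
by rewrite !row_mx0.
Qed.

End Coordinates.

(** * Size of the disk kernel *)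

Section DiskKernel.
Variables (R : realType) (F : finFieldType) (d : nat).
Hypothesis d_gt0 : (0 < d)%N.
Hypothesis F_odd : odd #|F|.
Local Notation C := R[i].
Local Notation k := d.-1.
Local Notation V := 'rV[F]_(2 * d).
Local Notation q := (#|F|%:R : R).

Let hn : (k + 1 + (k + 1) = 2 * d)%N.
Proof. by rewrite addn1 prednK // addnn mul2n. Qed.

Local Notation pt := (@coords F k (2 * d)).

Definition disk_param (u : 'rV[F]_k * 'rV[F]_k) : V := flat_point u.1 u.2.

(** The union of the translates of the disk along the last axis, that is, a
    paraboloid in the first d coordinates times the whole of the last d. *)
Definition saturated_param (u : 'rV[F]_k * 'rV[F]_k * F) : V :=
  flat_point u.1.1 u.1.2 + u.2 *: pt 0 0 0 1.

Lemma flat_pointE a b : flat_point a b = pt a (dot a a) b (dot a b).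
Proof. by []. Qed.

Lemma disk_param_inj : injective disk_param.
Proof. by move=> [a b] [a' b'] /flat_point_inj -/(_ d_gt0) [/= -> ->]. Qed.

Lemma saturated_param_inj : injective saturated_param.
Proof.
move=> [[a b] c] [[a' b'] c']; rewrite /saturated_param !flat_pointE /=.
rewrite !coordsDlast //; case/(coords_inj hn) => -> _ -> h.
by move: h => /addrI ->.
Qed.

Lemma sum_disk (T : nmodType) (f : V -> T) :
  \sum_(x in flat_disk F d) f x = \sum_u f (disk_param u).
Proof.
transitivity (\sum_(x in [set disk_param u | u in [set: _]]) f x); last first.
  rewrite big_imset /=; last by move=> x y _ _; apply: disk_param_inj.
  by apply: eq_bigl => u; rewrite inE.
apply: eq_bigl => x; apply/imset2P/imsetP => [[a b _ _ ->]|[[a b] _ ->]].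
  by exists (a, b).
by exists a b.
Qed.

Definition disk_kernel (m : V) : C :=
  (#|flat_disk F d|%:R^-1 : R)%:C * exp_sum R disk_param m.

Let q_gt0 : 0 < q. Proof. by rewrite ltr0n; apply/card_gt0P; exists 0. Qed.

Lemma card_disk_real : #|flat_disk F d|%:R = q ^+ k * q ^+ k :> R.
Proof.
rewrite card_flat_disk // natrX -exprD; congr (_ ^+ _).
by case: (d) d_gt0 => // m _; rewrite /= mul2n doubleS subn2 addnn.
Qed.

Definition paraboloid_sum (xi : 'rV[F]_k) (s : F) : C :=
  \sum_a chi R (dot a xi + dot a a * s).

(** The phase is affine in b, with slope eta + t a: the sum over b keeps the a
    for which this slope vanishes. *)
Lemma disk_kernel_coords xi s eta t :
  disk_kernel (pt xi s eta t) = (q ^- k)%:C *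
    \sum_(a | eta + t *: a == 0) chi R (dot a xi + dot a a * s).
Proof.
rewrite /disk_kernel /exp_sum card_disk_real.
rewrite -(pair_bigA _ (fun a b => chi R (dot (disk_param (a, b)) (pt xi s eta t)))) /=.
have -> : \sum_a \sum_b chi R (dot (disk_param (a, b)) (pt xi s eta t)) =
   (q ^+ k)%:C * \sum_(a | eta + t *: a == 0) chi R (dot a xi + dot a a * s).
  rewrite mulr_sumr [RHS]big_mkcond; apply: eq_bigr => a _.
  have h b : chi R (dot (disk_param (a, b)) (pt xi s eta t)) =
      chi R (dot a xi + dot a a * s) * chi R (dot b (eta + t *: a)).
    rewrite /disk_param flat_pointE dot_coords // -chiD /=.
    rewrite [dot b (_ + _)]dotC dotDl dotZl [dot eta b]dotC; congr (chi R (_ + (_ + _))).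
    by rewrite mulrC.
  rewrite (eq_bigr _ (fun b _ => h b)) -mulr_sumr sum_chi_dot.
  by case: ifP; rewrite ?mulr0 // natrX mulrC rmorphXn rmorph_nat.
rewrite mulrA -rmorphM; congr (_%:C * _).
by rewrite invfM mulfVK // expf_neq0 // gt_eqF.
Qed.

(** Squaring and shifting one variable by the other makes the phase linear in
    the remaining variable, with slope 2 s c; the characteristic is odd, so
    only c = 0 survives. *)
Lemma normc_paraboloid_sum xi s : s != 0 ->
  normc (paraboloid_sum xi s) ^+ 2 = q ^+ k.
Proof.
move=> s0; apply: complexI; rewrite -mul_conj.
have two : 2%:R != 0 :> F.
  apply/negP => h; have ch2 : 2%N \in [pchar F] by rewrite inE /=.
  have c2 : #|F| = (2 ^ logn 2 #|F|)%N by apply: card_pprimeChar ch2.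
  move: F_odd (finNzRing_gt1 F); rewrite c2 oddX orbF => /eqP ->.
  by rewrite expn0.
rewrite /paraboloid_sum mulr_suml.
pose f a := dot a xi + dot a a * s.
have shift a c : f (a + c) - f a = f c + dot a ((2%:R * s) *: c).
  rewrite /f !dotDl ![dot _ (a + c)]dotC ![dot _ (_ *: c)]dotC dotZl.
  by rewrite !dotDl [dot c a]dotC; ring.
have -> : \sum_a chi R (f a) * conjc (\sum_b chi R (f b)) =
    \sum_c chi R (f c) * \sum_b chi R (dot b ((2%:R * s) *: c)).
  rewrite -mulr_suml conjc_sum mulr_sumr.
  under eq_bigr => b _.
    rewrite conj_chi mulr_suml (reindex_inj (addrI b)) /=.
    under eq_bigr => c _ do rewrite -chiD shift chiD.
    over.
  by rewrite exchange_big; apply: eq_bigr => c _; rewrite mulr_sumr.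
rewrite (bigD1 0) //= [X in _ + X]big1 ?addr0 => [|c c0].
  rewrite scaler0 sum_chi_dot eqxx /f !dot0l mul0r addr0 chi0 mul1r natrX.
  by rewrite rmorphXn rmorph_nat.
rewrite sum_chi_dot ifN ?mulr0 // scaler_eq0 negb_or c0 andbT.
by rewrite mulf_neq0.
Qed.

(** When t <> 0, exactly one a satisfies eta + t a = 0. *)
Lemma disk_kernel_transverse m : dot (pt 0 0 0 1) m != 0 ->
  normc (disk_kernel m) <= q ^- k.
Proof.
have [xi [s [eta [t ->]]]] := coords_onto hn m.
rewrite dot_coords // !dot0l !mul0r mul1r !add0r => t0.
rewrite disk_kernel_coords (big_pred1 (- t^-1 *: eta)) => [|a].
  by rewrite normcM normc_chi mulr1 normc_real // invr_ge0 exprn_ge0 // ltW.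
rewrite pred1E addrC addr_eq0 -(inj_eq (scalerI (invr_neq0 t0))).
by rewrite scalerA mulVf // scale1r scalerN scaleNr.
Qed.

(** When t = 0, the kernel vanishes unless eta = 0, and then it is q^-k times a
    paraboloid sum: a Gauss sum if s <> 0, and a sum of linear phases that
    cancels if s = 0, since then xi <> 0. *)
Lemma disk_kernel_tangent m : dot (pt 0 0 0 1) m = 0 -> m != 0 ->
  normc (disk_kernel m) <= Num.sqrt q ^- k.
Proof.
have [xi [s [eta [t ->]]]] := coords_onto hn m.
rewrite dot_coords // !dot0l !mul0r mul1r !add0r => -> m0.
have B0 : 0 <= Num.sqrt q ^- k by rewrite invr_ge0 exprn_ge0 // sqrtr_ge0.
rewrite disk_kernel_coords; have [eta0|eta0] := eqVneq eta 0; last first.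
  rewrite big_pred0 ?mulr0 ?normc0 // => a.
  by rewrite scale0r addr0; apply/negbTE.
rewrite (eq_bigl xpredT) => [|a]; last by rewrite eta0 scale0r addr0 eqxx.
have [s0|s0] := eqVneq s 0.
  rewrite (eq_bigr (fun a => chi R (dot a xi))) => [|a _]; last first.
    by rewrite s0 mulr0 addr0.
  rewrite sum_chi_dot ifN ?mulr0 ?normc0 //.
  by apply: contraNneq m0 => xi0; rewrite xi0 s0 eta0 coords0 // eqxx.
rewrite -/(paraboloid_sum xi s) normcM normc_real; last first.
  by rewrite invr_ge0 exprn_ge0 // ltW.
have sq : Num.sqrt q ^+ 2 = q by rewrite sqr_sqrtr // ltW.
have -> : normc (paraboloid_sum xi s) = Num.sqrt q ^+ k.
  apply/eqP; rewrite -(eqrXn2 (n := 2)) ?normc_ge0 ?exprn_ge0 ?sqrtr_ge0 //.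
  by rewrite normc_paraboloid_sum // -exprM mulnC exprM sq.
have r0 : Num.sqrt q != 0 by rewrite gt_eqF // sqrtr_gt0.
by rewrite -{1}sq -exprM mul2n -addnn exprD invfM mulfVK // expf_neq0.
Qed.

Lemma disk_kernel0 : disk_kernel 0 = 1.
Proof.
rewrite -(coords0 F hn) disk_kernel_coords (eq_bigl xpredT) => [|a]; last first.
  by rewrite scale0r addr0 eqxx.
rewrite (eq_bigr (fun a => chi R (dot a 0))) => [|a _]; last first.
  by rewrite mulr0 addr0.
rewrite sum_chi_dot eqxx natrX -(rmorph_nat (real_complex R)).
rewrite -(rmorphXn (real_complex R)) -(rmorphM (real_complex R)) /= mulVf //.
by rewrite expf_neq0 // gt_eqF.
Qed.

(** Averaging characters along the last axis produces the indicator of t = 0. *)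
Lemma saturated_kernel m :
  ((q * #|flat_disk F d|%:R)^-1 : R)%:C * exp_sum R saturated_param m =
    if dot (pt 0 0 0 1) m == 0 then disk_kernel m else 0.
Proof.
rewrite /exp_sum /saturated_param.
rewrite -(pair_bigA _ (fun u c => chi R (dot (disk_param u + c *: pt 0 0 0 1) m))) /=.
have h u c : chi R (dot (disk_param u + c *: pt 0 0 0 1) m) =
    chi R (dot (disk_param u) m) * chi R (c * dot (pt 0 0 0 1) m).
  by rewrite dotDl chiD dotZl.
under eq_bigr do under eq_bigr do rewrite h.
under eq_bigr do rewrite -mulr_sumr sum_chi_mul.
case: ifP => _; last by rewrite big1 ?mulr0 // => i _; rewrite mulr0.
rewrite -mulr_suml mulrCA mulrC /disk_kernel; congr (_ * _).
rewrite -(rmorph_nat (real_complex R)) -(rmorphM (real_complex R)); congr _%:C.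
by rewrite invfM mulrC mulVKf // gt_eqF.
Qed.

End DiskKernel.

(** * The restriction inequality *)

Section Restriction.
Variables (R : realType) (F : finFieldType) (d : nat).
Hypothesis d_gt1 : (1 < d)%N.
Hypothesis F_odd : odd #|F|.
Local Notation C := R[i].
Local Notation k := d.-1.
Local Notation V := 'rV[F]_(2 * d).
Local Notation q := (#|F|%:R : R).
Local Notation e := (4 / k%:R : R).
Local Notation kappa := (translation_kernel (@disk_kernel R F d)).
Local Notation last_axis := (@coords F k (2 * d) 0 0 0 1).

Let d_gt0 : (0 < d)%N. Proof. exact: ltnW. Qed.
Let k_gt0 : (0 < k)%N. Proof. by case: (d) d_gt1 => [|[]]. Qed.
Let q_gt0 : 0 < q. Proof. by rewrite ltr0n; apply/card_gt0P; exists 0. Qed.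
Let q_ge1 : 1 <= q. Proof. by rewrite ler1n; apply/card_gt0P; exists 0. Qed.
Let e_gt0 : 0 < e. Proof. by rewrite divr_gt0 ?ltr0n. Qed.

Definition point_mass (m : V) : C := (m == 0)%:R.

Definition tangent_kernel (m : V) : C :=
  if dot last_axis m == 0 then disk_kernel R m else 0.

Lemma card_space : (#|F| ^ (2 * d))%:R = q ^+ 2 * #|flat_disk F d|%:R :> R.
Proof.
rewrite card_flat_disk // -natrX -natrM -expnD subnKC //.
by rewrite -[leqLHS]muln1 leq_mul2l.
Qed.

Let disk_gt0 : 0 < #|flat_disk F d|%:R :> R.
Proof. by rewrite card_disk_real // mulr_gt0 // exprn_gt0. Qed.

Lemma disk_kernel_l2 : l2_bounded kappa (q ^+ 2 / 2).
Proof.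
have c0 : 0 <= #|flat_disk F d|%:R^-1 :> R by rewrite invr_ge0 ler0n.
have := l2_bounded_exp_sum (@disk_param_inj F d d_gt0) c0.
by rewrite card_space [_ * (_ * _)]mulrCA mulVf ?gt_eqF // mulr1.
Qed.

Lemma tangent_kernel_l2 : l2_bounded (translation_kernel tangent_kernel) (q / 2).
Proof.
have c0 : 0 <= (q * #|flat_disk F d|%:R)^-1 by rewrite invr_ge0 mulr_ge0 ?ler0n.
have := l2_bounded_exp_sum (@saturated_param_inj F d d_gt0) c0.
have -> : (q * #|flat_disk F d|%:R)^-1 * (#|F| ^ (2 * d))%:R / 2 = q / 2.
  by rewrite card_space; field; rewrite !gt_eqF.
move=> h g f w w0; move: (h g f w w0); congr (normc _ <= _).
apply: eq_bigr => x _; apply: eq_bigr => y _; congr (_ * _).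
exact: saturated_kernel.
Qed.

Lemma kernel_form_point_mass (g h : V -> C) :
  kernel_form (translation_kernel point_mass) g h = \sum_x g x * conjc (h x).
Proof.
apply: eq_bigr => x _; rewrite (bigD1 x) //= /translation_kernel /point_mass.
rewrite subrr eqxx mul1r big1 ?addr0 // => y yx.
by rewrite subr_eq0 (negPf yx) mul0r.
Qed.

Lemma point_mass_l2 : l2_bounded (translation_kernel point_mass) (1 / 2).
Proof.
move=> g h s s0; rewrite kernel_form_point_mass /sqnorm.
apply: le_trans (normc_sum _ _ _) _.
rewrite !mulr_sumr -big_split /= mulr_sumr; apply: ler_sum => x _.
exact: normc_mul_le.
Qed.

(** One unit for the point mass and one [interp_const] for each of the other two
    pieces of the kernel; it is independent of the field. *)
Definition disk_const : R := 1 + 2 * interp_const e.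

Lemma disk_const_gt0 : 0 < disk_const.
Proof. by rewrite addr_gt0 // mulr_gt0 // interp_const_gt0. Qed.

(** Each of the two nontrivial pieces K1 (t <> 0) and K2 (t = 0 without the
    origin) is a difference of two combinations of characters, which gives the
    L^2 bounds q^2 / 2 + q / 2 <= q^2 and q / 2 + 1 / 2 <= q. *)
Lemma kernel_form_disk_le (G : V -> C) :
  let g := dual_power e G in let X := power_sum e G in 0 < X ->
  normc (kernel_form kappa g g) <= disk_const * X `^ (2 - 2 / (e + 2)).
Proof.
move=> g X X0.
pose K1 x y := kappa x y - translation_kernel tangent_kernel x y.
pose K2 x y :=
  translation_kernel tangent_kernel x y - translation_kernel point_mass x y.
have -> : kernel_form kappa g g = kernel_form K1 g g + kernel_form K2 g g
    + kernel_form (translation_kernel point_mass) g g.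
  rewrite -!big_split; apply: eq_bigr => x _; rewrite -!big_split.
  by apply: eq_bigr => y _; rewrite /K1 /K2 /= -!mulrDl subrKA subrK.
apply: le_trans (le_normcD _ _) _; rewrite /disk_const mulrDl addrC; apply: lerD.
  rewrite mul1r; apply: le_trans (sqnorm_level_le e_gt0 G).
  rewrite kernel_form_point_mass; apply: le_trans (normc_sum _ _ _) _.
  by apply: ler_sum => x _; rewrite normcM normc_conj expr2.
apply: le_trans (le_normcD _ _) _; rewrite mulr_natl mulr2n mulrDl; apply: lerD.
- apply: (kernel_form_balanced e_gt0 _ _ _ q_gt0 k_gt0 X0 erefl erefl erefl).
  + by rewrite exprn_ge0 // ltW.
  + move=> x y; rewrite /K1 /translation_kernel /tangent_kernel.
    case: eqVneq => h; last by rewrite subr0 disk_kernel_transverse.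
    by rewrite subrr normc0 invr_ge0 exprn_ge0 // ltW.
  + apply: l2_bounded_le (l2_bounded_sub disk_kernel_l2 tangent_kernel_l2).
    by move: q_ge1; generalize q => z z1; nra.
- have sq0 : 0 < Num.sqrt q by rewrite sqrtr_gt0.
  apply: (kernel_form_balanced e_gt0 _ _ _ sq0 k_gt0 X0 erefl erefl erefl).
  + by rewrite exprn_ge0 // ltW.
  + move=> x y; rewrite /K2 /translation_kernel /tangent_kernel /point_mass.
    have B0 : 0 <= Num.sqrt q ^- k by rewrite invr_ge0 exprn_ge0 // ltW.
    have [->|xy] := eqVneq (y - x) 0.
      by rewrite dotC dot0l eqxx disk_kernel0 // subrr normc0.
    rewrite subr0; case: eqVneq => h; last by rewrite normc0.
    exact: disk_kernel_tangent.
  + apply: l2_bounded_le (l2_bounded_sub tangent_kernel_l2 point_mass_l2).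
    rewrite sqr_sqrtr; last exact: ltW.
    by move: q_ge1; generalize q => z z1; lra.
Qed.

Lemma extension_pairing (f g : V -> C) :
  \sum_m extension f m * conjc (g m) = (#|flat_disk F d|%:R^-1 : R)%:C *
    \sum_u f (disk_param u) * conjc (fourier g (disk_param u)).
Proof.
rewrite /extension; under eq_bigr do rewrite -mulrA mulr_suml.
rewrite -mulr_sumr fmorphV rmorph_nat; congr (_ * _).
under eq_bigr do rewrite sum_disk //.
rewrite exchange_big; apply: eq_bigr => z _; rewrite /fourier conjc_sum mulr_sumr.
apply: eq_bigr => m _; move: (chi R _) => a; rewrite rmorphM /= conjcK; ring.
Qed.

(** X is the pairing of f with the Fourier transform of g over the disk, and
    [kernel_form_disk_le] bounds the L^2 norm of that transform; Cauchy-Schwarz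
    leaves X^2 <= D X^(2 - 2/r) |f|_2^2. *)
Lemma restriction_inequality (f : V -> C) :
  power_sum e (extension f) `^ (2 / (e + 2)) <=
    disk_const *
    (#|flat_disk F d|%:R^-1 * \sum_(x in flat_disk F d) normc (f x) ^+ 2).
Proof.
set X := power_sum _ _; set c := #|flat_disk F d|%:R^-1.
set N := \sum_(x in _) _.
have c0 : 0 < c by rewrite invr_gt0.
have c0' := ltW c0; have X0' : 0 <= X.
  by apply: sumr_ge0 => m _; apply: powR_ge0.
have r0 : 0 < e + 2 by rewrite addr_gt0.
have N0 : 0 <= N by apply: sumr_ge0 => x _; rewrite sqr_ge0.
have D0 := disk_const_gt0.
have [X0|X0] := eqVneq X 0.
  rewrite X0 powR0; last by rewrite gt_eqF // divr_gt0.
  by rewrite !mulr_ge0 // ltW.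
have {}X0 : 0 < X by rewrite lt_def X0.
pose g := dual_power e (extension f).
have XE : X%:C = \sum_m extension f m * conjc (g m).
  rewrite rmorph_sum; apply: eq_bigr => m _ /=.
  rewrite /g /dual_power conjc_scale mulrCA mul_conj -rmorphM /=.
  rewrite powRD ?powR_mulrn ?normc_ge0 //.
  by apply/implyP => h; rewrite (gt_eqF r0) in h.
pose Q := disk_const * X `^ (2 - 2 / (e + 2)).
have hQ : c * \sum_v normc (fourier g (disk_param v)) ^+ 2 <= Q.
  apply: le_trans (kernel_form_disk_le X0).
  rewrite kernel_form_exp_sum normcM normc_real //.
  under [in leRHS]eq_bigr do rewrite mul_conj.
  rewrite -rmorph_sum normc_real //.
  by apply: sumr_ge0 => v _; rewrite sqr_ge0.
have Xs s : 0 < s -> 2 * X <= s * (c * N) + s^-1 * Q.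
  move=> s0; have : normc (X%:C) <= c * (1 / 2 * (s * N +
      s^-1 * \sum_v normc (fourier g (disk_param v)) ^+ 2)).
    rewrite XE extension_pairing normcM normc_real //.
    rewrite ler_wpM2l //; apply: le_trans (normc_sum _ _ _) _.
    rewrite /N sum_disk // !mulr_sumr -big_split /= mulr_sumr.
    by apply: ler_sum => v _; apply: normc_mul_le.
  rewrite normc_real // => h.
  have := ler_wpM2l (_ : 0 <= s^-1) hQ; rewrite invr_ge0 ltW // => /(_ isT) h2.
  move: h h2; set S := \sum_v _; move=> h h2; lra.
have XD a b : X `^ (a + b) = X `^ a * X `^ b.
  by rewrite powRD //; apply/implyP => _; rewrite gt_eqF.
have Y0 : 0 < X `^ (2 - 2 / (e + 2)) by rewrite powR_gt0.
have XX : X ^+ 2 = X `^ (2 / (e + 2)) * X `^ (2 - 2 / (e + 2)).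
  by rewrite -XD -powR_mulrn ?ltW //; congr (_ `^ _); ring.
have Q0 : 0 < Q by rewrite mulr_gt0.
(* Q / X is the weight at which the second term is X. *)
have := Xs (Q / X) (divr_gt0 Q0 X0).
have -> : (Q / X)^-1 * Q = X by field; rewrite !gt_eqF.
rewrite mulr_natl mulr2n lerD2r -(ler_pM2r X0) mulrAC divfK ?gt_eqF //.
rewrite -expr2 XX /Q [leRHS]mulrAC ler_pM2r //.
Qed.

End Restriction.

Theorem theorem1p3 (R : realType) (d n : nat) (hd : (2 <= d)%N)
    (hn : n = (2 * d)%N) :
  exists C : R, 0 < C /\
    forall F : finFieldType, odd #|F| ->
      Rstar F R d 2%:E ((2 * n%:R + 4) / (n%:R - 2))%:E
        = Rstar F R d 2%:E ((2 * d%:R + 2) / (d%:R - 1))%:E /\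
      (Rstar F R d 2%:E ((2 * d%:R + 2) / (d%:R - 1))%:E <= C%:E)%E.
Proof.
have d1 : 0 < d%:R - 1 :> R by rewrite subr_gt0 ltr1n.
have k1 : d.-1%:R = d%:R - 1 :> R by case: d hd {d1 hn} => // m _; rewrite -natr1 addrK.
(* The exponent in the form e + 2 used above, with e = 4 / (d - 1). *)
have rE : (2 * d%:R + 2) / (d%:R - 1) = 4 / d.-1%:R + 2 :> R.
  by rewrite k1; field; rewrite gt_eqF.
have nE : (2 * n%:R + 4) / (n%:R - 2) = (2 * d%:R + 2) / (d%:R - 1) :> R.
  rewrite hn natrM; field; rewrite gt_eqF //=.
  by rewrite -[X in _ - X]mulr1 -mulrBr mulf_neq0 // gt_eqF.
exists (disk_const R d `^ 2^-1); split; first by rewrite powR_gt0 // disk_const_gt0.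
move=> F F_odd; rewrite nE; split=> //.
apply: ereal_inf_lbound; exists (disk_const R d `^ 2^-1) => // f.
rewrite rE /space_norm /disk_norm /Lp_norm mul1r.
rewrite (eq_bigl xpredT) => [|x]; last by rewrite inE.
under [in leRHS]eq_bigr do rewrite powR_mulrn ?normc_ge0 //.
have D0 := ltW (disk_const_gt0 R hd).
rewrite -/(power_sum _ _); set X := power_sum _ _.
have -> : X `^ (4 / d.-1%:R + 2)^-1 =
    (X `^ (2 / (4 / d.-1%:R + 2))) `^ 2^-1.
  by rewrite -powRrM mulrAC divff // mul1r.
have N0 : 0 <= #|flat_disk F d|%:R^-1 * \sum_(x in flat_disk F d) normc (f x) ^+ 2.
  by rewrite mulr_ge0 ?invr_ge0 ?ler0n // sumr_ge0 // => x _; rewrite sqr_ge0.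
rewrite -powRM //.
apply: ge0_ler_powR; rewrite ?nnegrE ?powR_ge0 ?invr_ge0 //.
  exact: mulr_ge0.
exact: restriction_inequality.
Qed.
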